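(* Let $k$ be an algebraically closed field and let $\mathcal{A}$ be a Deligne-finite $k$-linear abelian category. Fix an ordering $S_1,\ldots,S_n$ of (representatives of the isomorphism classes of) its simple objects, and let $P_i$, $\Delta_i$ and $\nabla_i$ be the corresponding projective covers, standard objects and costandard objects. Then $\mathcal{A}$ is highest weight with respect to the given ordering if and only if, for each $i=1,\ldots,n$, \[ [\Delta_i:S_i]=1 \quad\text{and}\quad [P_i]=\sum_{j=1}^n[\nabla_j:S_i]\,[\Delta_j] \ \text{ in } K(\mathcal{A}). \]
   Context: A $k$-linear abelian category $\mathcal{A}$ is Deligne finite if it is $\mathrm{Hom}$-finite and $\mathrm{Ext}^1$-finite (these are finite-dimensional over $k$), every object has finite length, it has finitely many simple objects up to isomorphism, and it has enough projectives. (Equivalently, $\mathcal{A}$ is equivalent to the category of finite-dimensional modules over a finite-dimensional $k$-algebra; in particular it also has enough injectives.) For a collection of objects, $\mathrm{Filt}(\ldots)$ denotes its extension-closure, i.e. the full subcategory of objects having a finite filtration whose factors are isomorphic to objects of the collection. Given the ordering $S_1,\ldots,S_n$, set $\mathcal{A}_i=\mathrm{Filt}(S_1,\ldots,S_i)$, a Serre subcategory. Let $P_i$ and $I_i$ be a projective cover and an injective hull of $S_i$ in $\mathcal{A}$. The standard object $\Delta_i$ is the maximal quotient of $P_i$ lying in $\mathcal{A}_i$; the costandard object $\nabla_i$ is the maximal subobject of $I_i$ lying in $\mathcal{A}_i$. $K(\mathcal{A})$ is the Grothendieck group, $[A]$ the class of $A$ in it, and $[A:S]$ the multiplicity of the simple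 object $S$ in a Jordan--Hölder filtration of $A$. $\mathcal{A}$ is highest weight with respect to the ordering $S_1,\ldots,S_n$ if $\mathrm{End}_{\mathcal{A}}(\Delta_i)\cong k$ and $P_i\in\mathrm{Filt}(\Delta_i,\ldots,\Delta_n)$ for each $i=1,\ldots,n$. *)

(* Defs.v *)
From HB Require Import structures.
From mathcomp Require Import all_boot all_order all_algebra.
From mathcomp Require Import boolp classical_sets.
From mathcomp Require Import freeg.

Set Implicit Arguments.
Unset Strict Implicit.
Unset Printing Implicit Defensive.

Import GRing.Theory.
Local Open Scope ring_scope.

Record linearCategory (k : fieldType) := LinearCategory {
  obj :> Type;
  mor : obj -> obj -> lmodType k;
  idm : forall X, mor X X;
  compm : forall X Y Z, mor Y Z -> mor X Y -> mor X Z;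
  comp1m : forall X Y (f : mor X Y), compm (idm Y) f = f;
  compm1 : forall X Y (f : mor X Y), compm f (idm X) = f;
  compmA : forall W X Y Z (f : mor W X) (g : mor X Y) (h : mor Y Z),
        compm h (compm g f) = compm (compm h g) f;
  compmPl : forall X Y Z (f : mor X Y) (a : k) (g g' : mor Y Z),
        compm (a *: g + g') f = a *: compm g f + compm g' f;
  compmPr : forall X Y Z (g : mor Y Z) (a : k) (f f' : mor X Y),
        compm g (a *: f + f') = a *: compm g f + compm g f'
}.

Arguments mor {k l} X Y.
Arguments idm {k l} X.
Arguments compm {k l X Y Z} g f.

Notation "g \c f" := (compm g f) (at level 40, left associativity) : ring_scope.

Section LinearCategory.
Context {k : fieldType} {A : linearCategory k}.
Implicit Types X Y Z W S P Q : A.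

Definition mono X Y (f : mor X Y) : Prop :=
  forall W (g h : mor W X), f \c g = f \c h -> g = h.

Definition epi X Y (f : mor X Y) : Prop :=
  forall W (g h : mor Y W), g \c f = h \c f -> g = h.

Definition isIso X Y (f : mor X Y) : Prop :=
  exists g : mor Y X, g \c f = idm X /\ f \c g = idm Y.

Definition isomorphic X Y : Prop := exists f : mor X Y, isIso f.

Definition isZero X : Prop :=
  forall Y, (forall f : mor X Y, f = 0) /\ (forall f : mor Y X, f = 0).

Definition isBiproduct X Y Z (i1 : mor X Z) (i2 : mor Y Z)
    (p1 : mor Z X) (p2 : mor Z Y) : Prop :=
  [/\ p1 \c i1 = idm X, p2 \c i2 = idm Y, p1 \c i2 = 0, p2 \c i1 = 0
    & i1 \c p1 + i2 \c p2 = idm Z].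

Definition isKernel X Y K (f : mor X Y) (i : mor K X) : Prop :=
  f \c i = 0 /\
  forall W (g : mor W X), f \c g = 0 -> exists! h : mor W K, i \c h = g.

Definition isCokernel X Y C (f : mor X Y) (p : mor Y C) : Prop :=
  p \c f = 0 /\
  forall W (g : mor Y W), g \c f = 0 -> exists! h : mor C W, h \c p = g.

Definition isPullback X Y Z W (f : mor X Z) (g : mor Y Z)
    (p : mor W X) (q : mor W Y) : Prop :=
  f \c p = g \c q /\
  forall T (x : mor T X) (y : mor T Y), f \c x = g \c y ->
    exists! t : mor T W, p \c t = x /\ q \c t = y.

Definition shortExact X Y Z (f : mor X Y) (g : mor Y Z) : Prop :=
  isKernel g f /\ isCokernel f g.

Definition isSimple S : Prop :=
  ~ isZero S /\ forall X (f : mor X S), mono f -> isZero X \/ isIso f.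

Definition isProjective P : Prop :=
  forall X Y (e : mor X Y) (f : mor P Y), epi e ->
    exists g : mor P X, e \c g = f.

Definition isInjective Q : Prop :=
  forall X Y (m : mor X Y) (f : mor X Q), mono m ->
    exists g : mor Y Q, g \c m = f.

Definition isProjectiveCover X P : Prop :=
  isProjective P /\ exists p : mor P X,
    epi p /\ forall W (f : mor W P), epi (p \c f) -> epi f.

Definition isInjectiveHull X Q : Prop :=
  isInjective Q /\ exists i : mor X Q,
    mono i /\ forall W (f : mor Q W), mono (f \c i) -> mono f.

(* The maximal quotient of X in C is the greatest one: every quotient of X that
   lies in C is a quotient of it. *)
Definition isMaxQuotient (C : A -> Prop) X D : Prop :=
  C D /\ exists q : mor X D, epi q /\
    forall Y (f : mor X Y), C Y -> epi f -> exists g : mor D Y, g \c q = f.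

Definition isMaxSubobject (C : A -> Prop) X N : Prop :=
  C N /\ exists i : mor N X, mono i /\
    forall Y (f : mor Y X), C Y -> mono f -> exists g : mor Y N, i \c g = f.

(* [filtration C X s]: X has a finite filtration whose successive factors, from
   the top down, are the members of s, all of which satisfy C. *)
Inductive filtration (C : A -> Prop) : A -> seq A -> Prop :=
| filtration_nil X : isZero X -> filtration C X [::]
| filtration_cons X' X T (f : mor X' X) (g : mor X T) s :
    shortExact f g -> C T -> filtration C X' s -> filtration C X (T :: s).

Definition Filt I (r : I -> Prop) (F : I -> A) X : Prop :=
  exists s, filtration (fun T => exists i, r i /\ isomorphic T (F i)) X s.

Definition hasFiniteLength X : Prop := exists s, filtration isSimple X s.

(* Well defined on objects of finite length by the Jordan-Hoelder theorem. *)
Definition multiplicity X S : nat :=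
  xget 0%N [set m | exists2 s, filtration isSimple X s
                             & m = count (fun T => `[< isomorphic T S >]) s].

Record extension X Y := Extension {
  emid : A;
  einc : mor Y emid;
  eprj : mor emid X;
  ext_exact : shortExact einc eprj
}.

Section Ext1.
Context {X Y : A}.
Implicit Types E : extension X Y.

Definition isSplit E : Prop := exists s : mor X (emid E), eprj E \c s = idm X.

(* The class of E' is a times the class of E: E' is the pushout of E along the
   endomorphism a of Y. For a = 1 this is Yoneda equivalence. *)
Definition isScaling (a : k) E E' : Prop :=
  exists m : mor (emid E) (emid E'),
    m \c einc E = einc E' \c (a *: idm Y) /\ eprj E' \c m = eprj E.

(* The kernel of the pullback G -> X is Y (+) Y; pushing G out along the
   addition Y (+) Y -> Y gives the Baer sum. The last condition says, on
   generalised elements, that q restricts to this addition. *)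
Definition isBaerSum E1 E2 E : Prop :=
  exists (G : A) (p1 : mor G (emid E1)) (p2 : mor G (emid E2))
         (q : mor G (emid E)),
    [/\ isPullback (eprj E1) (eprj E2) p1 p2,
        eprj E \c q = eprj E1 \c p1
      & forall T (t : mor T G) (y1 y2 : mor T Y),
          p1 \c t = einc E1 \c y1 -> p2 \c t = einc E2 \c y2 ->
          q \c t = einc E \c (y1 + y2)].

Inductive inExtSpan m (B : 'I_m -> extension X Y) : extension X Y -> Prop :=
| inExtSpan_gen i : inExtSpan B (B i)
| inExtSpan_zero E : isSplit E -> inExtSpan B E
| inExtSpan_scale a E E' : inExtSpan B E -> isScaling a E E' -> inExtSpan B E'
| inExtSpan_add E1 E2 E :
    inExtSpan B E1 -> inExtSpan B E2 -> isBaerSum E1 E2 E -> inExtSpan B E.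

End Ext1.

(* Ext^1(X, Y), the space of Yoneda classes of extensions under Baer sum, is
   spanned by finitely many classes. *)
Definition finiteDimExt1 X Y : Prop :=
  exists m (B : 'I_m -> extension X Y), forall E, inExtSpan B E.

Definition finiteDimHom X Y : Prop :=
  exists d, inhabited (Vector.axiom d (mor X Y)).

(* End(X) is isomorphic to k as a k-algebra. *)
Definition trivialEnd X : Prop :=
  exists phi : {linear k^o -> mor X X},
    [/\ phi 1 = idm X, forall a b : k, phi (a * b) = phi a \c phi b
      & bijective phi].

Definition isSimpleEnumeration n (S : 'I_n -> A) : Prop :=
  [/\ forall i, isSimple (S i),
      forall i j, isomorphic (S i) (S j) -> i = j
    & forall T, isSimple T -> exists i, isomorphic T (S i)].

(* The subcategory Filt(S_1, ..., S_i). *)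
Definition simpleFilt n (S : 'I_n -> A) (i : 'I_n) : A -> Prop :=
  Filt (fun j : 'I_n => (j <= i)%N) S.

Definition isStandard n (S P : 'I_n -> A) (D : 'I_n -> A) : Prop :=
  forall i, isMaxQuotient (simpleFilt S i) (P i) (D i).

Definition isCostandard n (S Q : 'I_n -> A) (N : 'I_n -> A) : Prop :=
  forall i, isMaxSubobject (simpleFilt S i) (Q i) (N i).

(* P and D are the projective covers and the standard objects of the chosen
   ordering of the simple objects. *)
Definition highestWeight n (P D : 'I_n -> A) : Prop :=
  forall i, trivialEnd (D i) /\ Filt (fun j : 'I_n => (i <= j)%N) D (P i).

End LinearCategory.

Section Properties.
Context {k : fieldType}.
Variable A : linearCategory k.

Record isAbelian : Prop := Abelian {
  abelian_zero : exists Z : A, isZero Z;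
  abelian_biproduct : forall X Y : A, exists (Z : A) (i1 : mor X Z)
    (i2 : mor Y Z) (p1 : mor Z X) (p2 : mor Z Y), isBiproduct i1 i2 p1 p2;
  abelian_kernel : forall (X Y : A) (f : mor X Y),
    exists (K : A) (i : mor K X), isKernel f i;
  abelian_cokernel : forall (X Y : A) (f : mor X Y),
    exists (C : A) (p : mor Y C), isCokernel f p;
  abelian_mono : forall (X Y : A) (f : mor X Y), mono f ->
    exists (Z : A) (g : mor Y Z), isKernel g f;
  abelian_epi : forall (X Y : A) (f : mor X Y), epi f ->
    exists (Z : A) (g : mor Z X), isCokernel g f
}.

Record isDeligneFinite : Prop := DeligneFinite {
  deligne_hom : forall X Y : A, finiteDimHom X Y;
  deligne_ext1 : forall X Y : A, finiteDimExt1 X Y;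
  deligne_length : forall X : A, hasFiniteLength X;
  deligne_simples : exists n (S : 'I_n -> A), isSimpleEnumeration S;
  deligne_projectives : forall X : A, exists (P : A) (p : mor P X),
    isProjective P /\ epi p
}.

(* The Grothendieck group: the free abelian group on the objects, modulo the
   subgroup generated by the relations [Y] = [X] + [Z] for short exact
   sequences 0 -> X -> Y -> Z -> 0. *)
Definition freeOb := {freeg {classic A} / int}.

Definition freeClass (X : A) : freeOb := << (X : {classic A}) >>.

Inductive grothendieckRelation : freeOb -> Prop :=
| grothendieckRelation_zero : grothendieckRelation 0
| grothendieckRelation_sub x y : grothendieckRelation x ->
    grothendieckRelation y -> grothendieckRelation (x - y)
| grothendieckRelation_exact (X Y Z : A) (f : mor X Y) (g : mor Y Z) :
    shortExact f g ->
    grothendieckRelation (freeClass Y - (freeClass X + freeClass Z)).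

Definition grothendieckRel : {pred freeOb} :=
  fun x => `[< grothendieckRelation x >].

Lemma grothendieckRel_zmod_closed : zmod_closed grothendieckRel.
Proof.
split=> [|x y /asboolP hx /asboolP hy]; apply/asboolP.
  exact: grothendieckRelation_zero.
exact: grothendieckRelation_sub.
Qed.

HB.instance Definition _ :=
  GRing.isZmodClosed.Build freeOb grothendieckRel grothendieckRel_zmod_closed.

Definition grothendieckGroup : zmodType := Quotient.quot grothendieckRel.

Definition groupClass (X : A) : grothendieckGroup :=
  \pi_(Quotient.quot grothendieckRel)%qT (freeClass X).

End Properties.

(* Main.v *)
From HB Require Import structures.
Require Import Defs.
From mathcomp Require Import all_boot all_order all_algebra.
From mathcomp Require Import boolp classical_sets.
From mathcomp Require Import freeg.

Set Implicit Arguments.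
Unset Strict Implicit.
Unset Printing Implicit Defensive.

Import GRing.Theory.
Local Open Scope ring_scope.

(* Both [X:S_l] and its dual are Hom-dimensions: [X:S_l] = dim Hom(P_l, X) =
   dim Hom(X, I_l). For X in Filt(S_1, ..., S_t) moreover dim Hom(X, N_t) =
   [X:S_t], since N_t is an injective hull of S_t there. Write h_j X for
   dim Hom(X, N_j). Every X satisfies
     [X:S_l] <= \sum_j h_j X * [D_j:S_l]   for all l,
   and equality for all l forces X to be filtered by those D_j with h_j X <> 0:
   if t is the largest index with S_t in X, a nonzero map P_t -> X factors
   through u : D_t -> X, and passing to coker u lowers h_t and raises no h_j; in
   the equality case u is mono. For X = P_i we have h_j P_i = [N_j:S_i]. The
   formula in K(A) is this equality, so it gives the filtration. Conversely, a
   D-filtration of P_i with multiplicities m_j has h_j P_i <= m_j by left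
   exactness, and the inequality above forces equality. *)

(** * Dimensions of vector spaces *)

Section Dimension.
Context {F : fieldType}.
Implicit Types U V W : lmodType F.

Definition finDim V : Prop := exists d, inhabited (Vector.axiom d V).

(** The default 0 is taken only when no finite basis exists; [vdimE] shows that the chosen basis is
    immaterial. *)
Definition vdim V : nat := xget 0%N [set d | inhabited (Vector.axiom d V)].

Lemma linear_matrix U V u v (bU : Vector.axiom u U) (bV : Vector.axiom v V)
    (f : U -> V) : linear f ->
  exists M : 'M[F]_(u, v), forall x, s2val bV (f x) = s2val bU x *m M.
Proof.
case: bU bV => cU linU [cU' cK c'K] [cV linV [cV' dK d'K]] linf /=.
have lin' : linear cU'.
  by move=> a x y; apply: (can_inj cK); rewrite c'K linU !c'K.
have ling : linear (cV \o f \o cU').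
  by move=> a x y; rewrite /= lin' linf linV.
pose g : {linear 'rV_u -> 'rV_v} := HB.pack (cV \o f \o cU')
  (GRing.isLinear.Build F 'rV_u 'rV_v *:%R (cV \o f \o cU') ling).
by exists (lin1_mx g) => x; rewrite mul_rV_lin1 /= cK.
Qed.

Lemma vaxiom_bij V d (b : Vector.axiom d V) : bijective (s2val b).
Proof. by case: b. Qed.

Lemma vaxiom_linear V d (b : Vector.axiom d V) : linear (s2val b).
Proof. by case: b. Qed.

Lemma vaxiom0 V d (b : Vector.axiom d V) : s2val b 0 = 0.
Proof.
by rewrite -(subrr (s2val b 0)) -scaleN1r addrC -vaxiom_linear scaler0 addr0.
Qed.

Lemma vaxiom_eq0 V d (b : Vector.axiom d V) x : s2val b x = 0 -> x = 0.
Proof. by rewrite -(vaxiom0 b) => /(bij_inj (vaxiom_bij b)). Qed.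

Lemma vaxiom_row V d (b : Vector.axiom d V) r : exists x, s2val b x = r.
Proof. by have [b' _ bK] := vaxiom_bij b; exists (b' r). Qed.

Lemma linear_map0 U V (f : U -> V) : linear f -> f 0 = 0.
Proof.
by move=> h; rewrite -[X in f X](addNr 0) -scaleN1r h scaleN1r addNr.
Qed.

(** In coordinates [f] and [g] are matrices A and B, and the hypothesis puts the kernel of B, of
    rank v - rank B, inside the row space of A. *)
Lemma vaxiom_dim_le U V W u v w (bU : Vector.axiom u U) (bV : Vector.axiom v V)
    (bW : Vector.axiom w W) (f : U -> V) (g : V -> W) :
    linear f -> linear g -> (forall y, g y = 0 -> exists x, f x = y) ->
  (v <= u + w)%N.
Proof.
move=> /(linear_matrix bU bV)[A hA] /(linear_matrix bV bW)[B hB] ex.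
have kerB : (kermx B <= A)%MS.
  apply/row_subP => i; have [y hy] := vaxiom_row bV (row i (kermx B)).
  have [|x fx] := ex y.
    by apply: (vaxiom_eq0 (b := bW)); rewrite hB hy -row_mul mulmx_ker row0.
  by apply/submxP; exists (s2val bU x); rewrite -hA fx.
have := mxrankS kerB; rewrite mxrank_ker leq_subLR => /leq_trans-> //.
by rewrite addnC leq_add ?rank_leq_row ?rank_leq_col.
Qed.

(** Injectivity gives A rank u, surjectivity gives B rank w, and AB = 0 bounds rank A by v - rank
    B. *)
Lemma vaxiom_dim_ge U V W u v w (bU : Vector.axiom u U) (bV : Vector.axiom v V)
    (bW : Vector.axiom w W) (f : U -> V) (g : V -> W) :
    linear f -> linear g -> injective f -> (forall z, exists y, g y = z) ->
    (forall x, g (f x) = 0) ->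
  (u + w <= v)%N.
Proof.
move=> linf ling injf surg gf0.
have [A hA] := linear_matrix bU bV linf; have [B hB] := linear_matrix bV bW ling.
have -> : u = \rank A.
  apply/esym/eqP; rewrite -/(row_free A) -kermx_eq0; apply/eqP/row_matrixP => i.
  have [x hx] := vaxiom_row bU (row i (kermx A)); rewrite row0 -hx.
  have -> : x = 0; last exact: vaxiom0.
  apply: injf; rewrite (linear_map0 linf); apply: (vaxiom_eq0 (b := bV)).
  by rewrite hA hx -row_mul mulmx_ker row0.
have -> : w = \rank B.
  apply/esym/eqP; rewrite -/(row_full B) -sub1mx; apply/row_subP => i.
  have [z hz] := vaxiom_row bW (row i 1%:M); have [y gy] := surg z.
  by apply/submxP; exists (s2val bV y); rewrite -hB gy.
have AB0 : A *m B = 0.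
  apply/row_matrixP => i; rewrite row_mul row0.
  have [x hx] := vaxiom_row bU (delta_mx 0 i).
  by rewrite rowE -hx -hA -hB gf0 vaxiom0.
have : (A <= kermx B)%MS by apply/sub_kermxP.
move/mxrankS; rewrite mxrank_ker => h.
by rewrite addnC -leq_subRL ?rank_leq_row.
Qed.

Lemma vaxiom_rV d : Vector.axiom d ('rV[F]_d).
Proof. by exists id => //; exists id. Qed.

Lemma vaxiom_dim_inj U V u v (bU : Vector.axiom u U) (bV : Vector.axiom v V)
    (f : U -> V) : linear f -> injective f -> (u <= v)%N.
Proof.
(* Injectivity is exactness in the middle of 0 -> U -> V. *)
move=> linf injf; rewrite -[v]add0n.
apply: (vaxiom_dim_le (vaxiom_rV 0) bU bV (f := fun=> 0) (g := f)) => // [a x y|y].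
  by rewrite scaler0 addr0.
by rewrite -(linear_map0 linf) => /injf->; exists 0.
Qed.

Lemma vdimE V d : Vector.axiom d V -> vdim V = d.
Proof.
move=> b; rewrite /vdim; case: xgetP => [e _ [b']|/(_ d)[]]; last by constructor.
by apply/eqP; rewrite eqn_leq (vaxiom_dim_inj b' b (f := id)) //
  (vaxiom_dim_inj b b' (f := id)).
Qed.

Lemma finDimP V : finDim V -> inhabited (Vector.axiom (vdim V) V).
Proof. by case=> d [b]; rewrite (vdimE b); constructor. Qed.

Lemma vdim_rV d : vdim 'rV[F]_d = d.
Proof. exact: vdimE (vaxiom_rV d). Qed.

Lemma finDim_rV d : finDim 'rV[F]_d.
Proof. by exists d; constructor; exact: vaxiom_rV. Qed.

Lemma vdim_exact_le U V W (f : U -> V) (g : V -> W) :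
    finDim U -> finDim V -> finDim W -> linear f -> linear g ->
    (forall y, g y = 0 -> exists x, f x = y) ->
  (vdim V <= vdim U + vdim W)%N.
Proof. by move=> /finDimP[bU] /finDimP[bV] /finDimP[bW]; exact: vaxiom_dim_le. Qed.

Lemma vdim_exact_ge U V W (f : U -> V) (g : V -> W) :
    finDim U -> finDim V -> finDim W -> linear f -> linear g ->
    injective f -> (forall z, exists y, g y = z) -> (forall x, g (f x) = 0) ->
  (vdim U + vdim W <= vdim V)%N.
Proof. by move=> /finDimP[bU] /finDimP[bV] /finDimP[bW]; exact: vaxiom_dim_ge. Qed.

Lemma vdim_inj U V (f : U -> V) :
  finDim U -> finDim V -> linear f -> injective f -> (vdim U <= vdim V)%N.
Proof. by move=> /finDimP[bU] /finDimP[bV]; exact: vaxiom_dim_inj. Qed.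

Lemma vdim_surj U V (f : U -> V) :
    finDim U -> finDim V -> linear f -> (forall y, exists x, f x = y) ->
  (vdim V <= vdim U)%N.
Proof.
move=> fU fV linf surf; rewrite -[vdim V]add0n -{1}(vdim_rV 0).
apply: (vdim_exact_ge (f := fun=> 0) (g := f) (finDim_rV 0) fU fV) => //.
- by move=> a x y; rewrite scaler0 addr0.
- by move=> x y _; apply/rowP; case.
- by move=> _; exact: linear_map0.
Qed.

Lemma vdim_eq0 V : finDim V -> vdim V = 0%N <-> forall x : V, x = 0.
Proof.
move=> fV; split=> [V0 x|V0].
  have [b] := finDimP fV; move: b; rewrite V0 => b.
  by apply: (vaxiom_eq0 (b := b)); apply/rowP; case.
apply/eqP; rewrite -leqn0 -(vdim_rV 0).
apply: (vdim_inj fV (finDim_rV 0) (f := fun=> 0)) => [a x y|x y _].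
  by rewrite scaler0 addr0.
by rewrite (V0 x) (V0 y).
Qed.

Lemma vdim_gt0 V (x : V) : finDim V -> x <> 0 -> (0 < vdim V)%N.
Proof. by move=> fV x0; rewrite lt0n; apply/eqP => /(vdim_eq0 fV)/(_ x). Qed.

Lemma vdim_neq0 V : vdim V <> 0%N -> finDim V -> exists x : V, x <> 0.
Proof.
move=> V0 fV; apply: contrapT => h; apply/V0/(vdim_eq0 fV) => x.
by apply: contrapT => x0; apply: h; exists x.
Qed.

Lemma line_linear V (x : V) : linear (fun r : 'rV[F]_1 => r 0 0 *: x).
Proof. by move=> a r s; rewrite !mxE scalerDl scalerA. Qed.

Lemma vdim_line V (x : V) :
  finDim V -> x <> 0 -> (forall y, exists a, y = a *: x) -> vdim V = 1%N.
Proof.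
move=> fV x0 lx; apply/eqP; rewrite eqn_leq (vdim_gt0 fV x0) andbT -(vdim_rV 1).
apply: (vdim_surj (finDim_rV 1) fV (@line_linear _ x)) => y.
by have [a ->] := lx y; exists (const_mx a); rewrite mxE.
Qed.

Lemma vdim1_line V (x y : V) :
  finDim V -> vdim V = 1%N -> x <> 0 -> exists a, y = a *: x.
Proof.
move=> /finDimP[b] V1 x0; move: b; rewrite V1 => b.
have bx0 : s2val b x 0 0 != 0.
  apply/eqP => h; apply/x0/(vaxiom_eq0 (b := b))/rowP => i.
  by rewrite ord1 h mxE.
exists (s2val b y 0 0 / s2val b x 0 0).
apply: (bij_inj (vaxiom_bij b)); rewrite -[_ *: x]addr0 vaxiom_linear vaxiom0 addr0.
by apply/rowP => i; rewrite ord1 mxE divfK.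
Qed.

End Dimension.

(** As [x0] makes V nonzero, the characteristic polynomial of a matrix of [f] is not constant and
    has a root in the algebraically closed field. *)
Lemma eigenvector_exists (k : closedFieldType) (V : lmodType k) (f : V -> V) (x0 : V) :
  finDim V -> linear f -> x0 <> 0 -> exists a x, x <> 0 /\ f x = a *: x.
Proof.
move=> fV linf x00; have := vdim_gt0 fV x00; have [b] := finDimP fV.
have [M hM] := linear_matrix b b linf.
move: (vdim V) b M hM => [|d] b M hM // _.
have /closed_rootP[a] : size (char_poly M) != 1%N by rewrite size_char_poly.
rewrite -eigenvalue_root_char => /eigenvalueP[r rM r0].
have [x hx] := vaxiom_row b r; exists a, x; split.
  by move=> x_0; rewrite -hx x_0 vaxiom0 eqxx in r0.
apply: (bij_inj (vaxiom_bij b)).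
by rewrite hM hx rM -[a *: x]addr0 vaxiom_linear vaxiom0 addr0 hx.
Qed.

(** * Linear and abelian categories *)

Section LinearCategoryTheory.
Context {k : fieldType} {A : linearCategory k}.
Implicit Types X Y Z W S T K : A.

Lemma compm_linear X Y Z (g : mor Y Z) : linear (fun f : mor X Y => g \c f).
Proof. by move=> a f f'; rewrite compmPr. Qed.

Lemma compmr_linear X Y Z (f : mor X Y) : linear (fun g : mor Y Z => g \c f).
Proof. by move=> a g g'; rewrite compmPl. Qed.

Lemma compm0 X Y Z (g : mor Y Z) : g \c (0 : mor X Y) = 0.
Proof. exact: linear_map0 (compm_linear g). Qed.

Lemma comp0m X Y Z (f : mor X Y) : (0 : mor Y Z) \c f = 0.
Proof. exact: linear_map0 (compmr_linear f). Qed.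

Lemma compmZ X Y Z (g : mor Y Z) a (f : mor X Y) : g \c (a *: f) = a *: (g \c f).
Proof. by have := compmPr g a f 0; rewrite !addr0 compm0 addr0. Qed.

Lemma compZm X Y Z (g : mor Y Z) a (f : mor X Y) : (a *: g) \c f = a *: (g \c f).
Proof. by have := compmPl f a g 0; rewrite !addr0 comp0m addr0. Qed.

Lemma compmB X Y Z (g : mor Y Z) (f f' : mor X Y) : g \c (f - f') = g \c f - g \c f'.
Proof. by rewrite addrC -scaleN1r compmPr scaleN1r addrC. Qed.

Lemma compBm X Y Z (g g' : mor Y Z) (f : mor X Y) : (g - g') \c f = g \c f - g' \c f.
Proof. by rewrite addrC -scaleN1r compmPl scaleN1r addrC. Qed.

Lemma monoP X Y (f : mor X Y) : mono f <-> forall W (h : mor W X), f \c h = 0 -> h = 0.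
Proof.
split=> [mf W h fh|mf W g h fgh]; first by apply: mf; rewrite fh compm0.
by apply/eqP; rewrite -subr_eq0; apply/eqP/mf; rewrite compmB fgh subrr.
Qed.

Lemma epiP X Y (f : mor X Y) : epi f <-> forall W (h : mor Y W), h \c f = 0 -> h = 0.
Proof.
split=> [mf W h fh|mf W g h fgh]; first by apply: mf; rewrite fh comp0m.
by apply/eqP; rewrite -subr_eq0; apply/eqP/mf; rewrite compBm fgh subrr.
Qed.

Lemma mono_eq0 X Y W (f : mor X Y) (h : mor W X) : mono f -> f \c h = 0 -> h = 0.
Proof. by move/monoP; apply. Qed.

Lemma epi_eq0 X Y W (f : mor X Y) (h : mor Y W) : epi f -> h \c f = 0 -> h = 0.
Proof. by move/epiP; apply. Qed.

Lemma isZeroP X : isZero X <-> idm X = 0.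
Proof.
split=> [zX|idX0 Y]; first by have [/(_ (idm X))] := zX X.
by split=> f; rewrite -1?[f]compm1 -1?[f]comp1m idX0 ?compm0 ?comp0m.
Qed.

Lemma isZero_epi X Y (f : mor X Y) : epi f -> f = 0 -> isZero Y.
Proof. by move=> /epiP mf f0; apply/isZeroP/mf; rewrite f0 compm0. Qed.

Lemma isIso_mono X Y (f : mor X Y) : isIso f -> mono f.
Proof.
by case=> g [gf _]; apply/monoP => W h fh; rewrite -[h]comp1m -gf -compmA fh compm0.
Qed.

Lemma isIso_epi X Y (f : mor X Y) : isIso f -> epi f.
Proof.
by case=> g [_ fg]; apply/epiP => W h fh; rewrite -[h]compm1 -fg compmA fh comp0m.
Qed.

Lemma epi_comp X Y Z (g : mor Y Z) (f : mor X Y) : epi g -> epi f -> epi (g \c f).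
Proof. by move=> mg mf W u v; rewrite !compmA => /mf/mg. Qed.

Lemma isomorphic_refl X : isomorphic X X.
Proof. by exists (idm X), (idm X); rewrite comp1m. Qed.

Lemma isomorphic_sym X Y : isomorphic X Y -> isomorphic Y X.
Proof. by case=> f [g [gf fg]]; exists g, f. Qed.

Lemma kernel_mono X Y K (f : mor X Y) (i : mor K X) : isKernel f i -> mono i.
Proof.
case=> fi ker; apply/monoP => W h ih.
have [|u [_ uniq]] := ker W 0; first exact: compm0.
by rewrite -(uniq h ih) (uniq 0) ?compm0.
Qed.

Lemma cokernel_epi X Y C (f : mor X Y) (p : mor Y C) : isCokernel f p -> epi p.
Proof.
case=> fi ker; apply/epiP => W h ih.
have [|u [_ uniq]] := ker W 0; first exact: comp0m.
by rewrite -(uniq h ih) (uniq 0) ?comp0m.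
Qed.

Lemma kernel_lift X Y K (f : mor X Y) (i : mor K X) W (g : mor W X) :
  isKernel f i -> f \c g = 0 -> exists h : mor W K, i \c h = g.
Proof. by case=> _ ker /ker[h [hg _]]; exists h. Qed.

Lemma cokernel_desc X Y C (f : mor X Y) (p : mor Y C) W (g : mor Y W) :
  isCokernel f p -> g \c f = 0 -> exists h : mor C W, h \c p = g.
Proof. by case=> _ ker /ker[h [hg _]]; exists h. Qed.

Lemma isKernelI X Y K (f : mor X Y) (i : mor K X) : mono i -> f \c i = 0 ->
    (forall W (g : mor W X), f \c g = 0 -> exists h : mor W K, i \c h = g) ->
  isKernel f i.
Proof.
move=> mi fi0 ex; split=> // W g /ex[h hg]; exists h; split=> // h' h'g.
by apply: mi; rewrite hg h'g.
Qed.

Lemma isCokernelI X Y C (f : mor X Y) (p : mor Y C) : epi p -> p \c f = 0 ->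
    (forall W (g : mor Y W), g \c f = 0 -> exists h : mor C W, h \c p = g) ->
  isCokernel f p.
Proof.
move=> mi fi0 ex; split=> // W g /ex[h hg]; exists h; split=> // h' h'g.
by apply: mi; rewrite hg h'g.
Qed.

(** Lets results on projective covers be reused for injective hulls; the Hom spaces are those of [A]
    with arguments exchanged, so Hom-dimensions agree by conversion. *)
Definition opposite : linearCategory k :=
  @LinearCategory k A (fun X Y => mor Y X) (fun X => idm X)
    (fun X Y Z g f => f \c g) (fun X Y f => compm1 f) (fun X Y f => comp1m f)
    (fun W X Y Z f g h => esym (compmA h g f))
    (fun X Y Z f a g g' => compmPr f a g g')
    (fun X Y Z g a f f' => compmPl g a f f').

Lemma shortExact_opposite X Y Z (f : mor X Y) (g : mor Y Z) :
  shortExact f g -> shortExact (g : @mor k opposite Z Y) (f : @mor k opposite Y X).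
Proof. by case=> kf cg; split. Qed.

Lemma opposite_abelian : isAbelian A -> isAbelian opposite.
Proof.
case=> z b ker coker mon ep; split.
- by have [Z zZ] := z; exists Z => Y; have [h1 h2] := zZ Y; split.
- move=> X Y; have [Z [i1 [i2 [p1 [p2 [h1 h2 h3 h4 h5]]]]]] := b X Y.
  by exists Z, p1, p2, i1, i2.
- move=> X Y f; exact: coker.
- move=> X Y f; exact: ker.
- move=> X Y f; exact: ep.
- move=> X Y f; exact: mon.
Qed.

End LinearCategoryTheory.

(** * Exact sequences, simple objects and Schur's lemma *)

Section AbelianTheory.
Context {k : fieldType} {A : linearCategory k}.
Hypothesis hA : isAbelian A.
Implicit Types X Y Z W S T K P Q : A.

(** A mono [f] is the kernel of some g; if [f] is also epi then g = 0, and the identity of Y lifts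
    through [f]. *)
Lemma mono_epi_iso X Y (f : mor X Y) : mono f -> epi f -> isIso f.
Proof.
move=> mf ef; have [Z [g kg]] := abelian_mono hA mf.
have g0 : g = 0 := epi_eq0 ef kg.1.
have [|h hf] := kernel_lift (g := idm Y) kg; first by rewrite g0 comp0m.
exists h; split=> //; apply: mf; by rewrite compmA hf comp1m compm1.
Qed.

(** The epi [g] is a cokernel of some h, and h factors through [f]; so a map killing [f] kills h and
    descends along [g]. *)
Lemma epi_shortExact X Y Z (f : mor X Y) (g : mor Y Z) :
  epi g -> isKernel g f -> shortExact f g.
Proof.
move=> eg kf; split=> //; apply: isCokernelI (kf.1) _ => // W w wf.
have [V [h ch]] := abelian_epi hA eg.
have [h' fh'] := kernel_lift kf ch.1.
by apply: (cokernel_desc ch); rewrite -fh' compmA wf comp0m.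
Qed.

Lemma mono_shortExact X Y Z (f : mor X Y) (g : mor Y Z) :
  mono f -> isCokernel f g -> shortExact f g.
Proof.
move=> mf cg; split=> //; apply: isKernelI (cg.1) _ => // W w gw.
have [V [h kh]] := abelian_mono hA mf.
have [h' h'g] := cokernel_desc cg kh.1.
by apply: (kernel_lift kh); rewrite -h'g -compmA gw compm0.
Qed.

Lemma epi_exact X Y (g : mor X Y) : epi g -> exists K (f : mor K X), shortExact f g.
Proof.
by move=> eg; have [K [f kf]] := abelian_kernel hA g; exists K, f; exact: epi_shortExact.
Qed.

Lemma mono_exact X Y (f : mor X Y) : mono f -> exists C (g : mor Y C), shortExact f g.
Proof.
by move=> mf; have [K [g cg]] := abelian_cokernel hA f; exists K, g; exact: mono_shortExact.
Qed.

Lemma kernel_zero_mono X Y K (f : mor X Y) (i : mor K X) :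
  isKernel f i -> isZero K -> mono f.
Proof.
move=> ki zK; apply/monoP => W h fh; have [u <-] := kernel_lift ki fh.
by have [_ /(_ u)->] := zK W; rewrite compm0.
Qed.

(** The definition of simplicity speaks of subobjects; applied to the kernel of [f] it controls
    quotients too, which makes simplicity self-dual. *)
Lemma simple_epi S X (f : mor S X) : isSimple S -> epi f -> isZero X \/ isIso f.
Proof.
move=> [_ sS] ef; have [K [i ki]] := abelian_kernel hA f.
have [zK|ii] := sS K i (kernel_mono ki).
  by right; apply: mono_epi_iso => //; exact: kernel_zero_mono ki zK.
by left; apply: (isZero_epi ef); apply: epi_eq0 ki.1; exact: isIso_epi.
Qed.

Lemma simple_opposite S : isSimple S -> @isSimple k (@opposite k A) S.
Proof.
move=> sS; split=> [zS|X f mf].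
  by apply: (sS.1) => Y; have [h1 h2] := zS Y; split.
have [zX|[g [gf fg]]] := simple_epi sS (mf : epi (f : mor S X)).
  by left=> Y; have [h1 h2] := zX Y; split.
by right; exists g.
Qed.

Lemma schur S T (f : mor S T) : isSimple S -> isSimple T -> f <> 0 -> isIso f.
Proof.
move=> sS [_ sT] f0; have [K [i ki]] := abelian_kernel hA f.
have [zK|ii] := sS.2 K i (kernel_mono ki).
  by have [/(sS.1)|] := sT S f (kernel_zero_mono ki zK).
by case: f0; apply: epi_eq0 ki.1; exact: isIso_epi.
Qed.

Lemma to_simple_epi X S (f : mor X S) : isSimple S -> f <> 0 -> epi f.
Proof.
move=> sS f0; have [C [c cc]] := abelian_cokernel hA f.
have [zC|[g [gc _]]] := simple_epi sS (cokernel_epi cc).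
  apply/epiP => W h hf; have [u <-] := cokernel_desc cc hf.
  by have [/(_ u)-> _] := zC W; rewrite comp0m.
by case: f0; rewrite -[f]comp1m -gc -compmA cc.1 compm0.
Qed.

(** Let i be the kernel of [f]. If p i were nonzero it would be epi, so i would be epi by
    essentiality of [p], and f = 0. Hence [p] factors through [f] by a nonzero map T -> S,
    invertible by [schur]. *)
Lemma cover_to_simple S P T (p : mor P S) (f : mor P T) :
    isSimple S -> isSimple T -> epi p ->
    (forall W (g : mor W P), epi (p \c g) -> epi g) -> f <> 0 ->
  exists h : mor S T, isIso h /\ f = h \c p.
Proof.
move=> sS sT ep cov f0; have ef := to_simple_epi sT f0.
have [K [i ex]] := epi_exact ef.
have pi0 : p \c i = 0.
  apply: contrapT => pi0; apply: f0; apply: epi_eq0 ex.1.1.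
  exact: cov (to_simple_epi sS pi0).
have [h hf] := cokernel_desc ex.2 pi0.
have [|g [gh hg]] := schur (f := h) sT sS.
  by move=> h0; apply: (sS.1); apply: (isZero_epi ep); rewrite -hf h0 comp0m.
exists g; split; first by exists h.
by rewrite -hf compmA gh comp1m.
Qed.

End AbelianTheory.

(** * Dimensions of morphism spaces *)

Section HomDimension.
Context {k : fieldType} {A : linearCategory k}.
Hypothesis homfin : forall X Y : A, finiteDimHom X Y.
Implicit Types X Y Z W S T K P Q : A.

Definition homdim X Y := vdim (mor X Y).

Lemma homdim_left_exact Q X Y Z (f : mor X Y) (g : mor Y Z) :
  shortExact f g -> (homdim Q Y <= homdim Q X + homdim Q Z)%N.
Proof.
case=> kf _; apply: (vdim_exact_le (homfin _ _) (homfin _ _) (homfin _ _)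
  (compm_linear f) (compm_linear g)) => y gy.
exact: kernel_lift kf gy.
Qed.

Lemma homdim_left_exactl N X Y Z (f : mor X Y) (g : mor Y Z) :
  shortExact f g -> (homdim Y N <= homdim X N + homdim Z N)%N.
Proof.
case=> _ cg; rewrite addnC.
apply: (vdim_exact_le (homfin _ _) (homfin _ _) (homfin _ _)
  (compmr_linear g) (compmr_linear f)) => y yf.
exact: cokernel_desc cg yf.
Qed.

Lemma homdim_exact Q X Y Z (f : mor X Y) (g : mor Y Z) :
  isProjective Q -> shortExact f g -> homdim Q Y = (homdim Q X + homdim Q Z)%N.
Proof.
move=> pQ ex; apply/eqP; rewrite eqn_leq (homdim_left_exact _ ex).
apply: (vdim_exact_ge (homfin _ _) (homfin _ _) (homfin _ _)
  (compm_linear f) (compm_linear g)).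
- by move=> u v; exact: (kernel_mono ex.1).
- by move=> z; apply: pQ; exact: cokernel_epi ex.2.
- by move=> x; rewrite compmA ex.1.1 comp0m.
Qed.

Lemma homdim_mono Q X Y (f : mor X Y) : mono f -> (homdim Q X <= homdim Q Y)%N.
Proof.
move=> mf; apply: (vdim_inj (homfin _ _) (homfin _ _) (compm_linear f)) => u v.
exact: mf.
Qed.

Lemma homdim_epi Q X Y (f : mor X Y) :
  isProjective Q -> epi f -> (homdim Q Y <= homdim Q X)%N.
Proof.
move=> pQ ef; apply: (vdim_surj (homfin _ _) (homfin _ _) (compm_linear f)) => y.
exact: pQ.
Qed.

Lemma homdim_epil N X Y (f : mor X Y) : epi f -> (homdim Y N <= homdim X N)%N.
Proof.
move=> ef; apply: (vdim_inj (homfin _ _) (homfin _ _) (compmr_linear f)) => u v.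
exact: ef.
Qed.

Lemma homdim_iso Q X Y : isomorphic X Y -> homdim Q X = homdim Q Y.
Proof.
case=> f fi; have [g [gf fg]] := fi; apply/eqP; rewrite eqn_leq.
rewrite (homdim_mono _ (isIso_mono fi)) (@homdim_mono Q _ _ g) //.
by apply: isIso_mono; exists f.
Qed.

Lemma homdim_isol N X Y : isomorphic X Y -> homdim X N = homdim Y N.
Proof.
case=> f fi; have [g [gf fg]] := fi; apply/eqP; rewrite eqn_leq.
rewrite (homdim_epil _ (isIso_epi fi)) (@homdim_epil N _ _ g) //.
by apply: isIso_epi; exists f.
Qed.

Lemma homdim_eq0 X Y : homdim X Y = 0%N <-> forall f : mor X Y, f = 0.
Proof. exact: vdim_eq0 (homfin _ _). Qed.

Lemma homdim_zero Q X : isZero X -> homdim Q X = 0%N.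
Proof. by move=> zX; apply/homdim_eq0; have [_] := zX Q. Qed.

Lemma homdim_zerol N X : isZero X -> homdim X N = 0%N.
Proof. by move=> zX; apply/homdim_eq0; have [] := zX N. Qed.

End HomDimension.

(** * Multiplicities of simple objects as Hom-dimensions *)

Section Schur.
Context {k : closedFieldType} {A : linearCategory k}.
Hypotheses (hA : isAbelian A) (homfin : forall X Y : A, finiteDimHom X Y).
Implicit Types X Y S T P : A.

(** Composition with [f] has an eigenvector g in End(S). It is nonzero, hence invertible, and
    cancelling it in f g = a g gives the claim. *)
Lemma simple_endomorphism S (f : mor S S) : isSimple S -> exists a, f = a *: idm S.
Proof.
move=> sS; have [|a [g [g0 fg]]] :=
    eigenvector_exists (x0 := idm S) (homfin S S) (compm_linear f).
  by move/isZeroP; exact: sS.1.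
have /epiP : epi g by apply/isIso_epi/schur.
move/(_ S (f - a *: idm S)); rewrite compBm compZm comp1m fg subrr => /(_ erefl).
by move/eqP; rewrite subr_eq0 => /eqP; exists a.
Qed.

Lemma homdim_cover_simple S P T : isSimple S -> isSimple T -> isProjectiveCover S P ->
  homdim P T = `[< isomorphic T S >].
Proof.
move=> sS sT [pP [p [ep cov]]]; case: asboolP => [iTS|niTS].
  rewrite (homdim_iso homfin _ iTS); apply: (vdim_line (homfin P S) (x := p)).
    by move=> p0; apply: (sS.1); exact: isZero_epi ep p0.
  move=> f; have [->|f0] := pselect (f = 0); first by exists 0; rewrite scale0r.
  have [h [_ ->]] := cover_to_simple hA sS sS ep cov f0.
  by have [a ->] := simple_endomorphism h sS; exists a; rewrite compZm comp1m.
apply/homdim_eq0 => // f; apply: contrapT => f0; apply: niTS; apply: isomorphic_sym.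
by have [h [hi _]] := cover_to_simple hA sS sT ep cov f0; exists h.
Qed.

Lemma homdim_filtration S P X s : isSimple S -> isProjectiveCover S P ->
  filtration isSimple X s ->
  homdim P X = count (fun T => `[< isomorphic T S >]) s.
Proof.
move=> sS cP; elim=> [Y zY|X' Y T f g t ex sT _ IH] /=; first exact: homdim_zero.
by rewrite (homdim_exact homfin cP.1 ex) IH addnC (homdim_cover_simple sS sT cP).
Qed.

End Schur.

Section Multiplicity.
Context {k : closedFieldType} {A : linearCategory k}.
Hypotheses (hA : isAbelian A) (homfin : forall X Y : A, finiteDimHom X Y).
Hypothesis finlength : forall X : A, hasFiniteLength X.
Implicit Types X Y S T P I : A.

(** Every composition series of X yields the same count, dim Hom(P, X), so the choice made by [xget]
    is immaterial. *)
Lemma homdim_multiplicity S P X : isSimple S -> isProjectiveCover S P ->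
  multiplicity X S = homdim P X.
Proof.
move=> sS cP; rewrite /multiplicity.
case: xgetP => [m _ [s fs ->]|nex]; first by rewrite (homdim_filtration hA homfin sS cP fs).
by have [s fs] := finlength X; case: (nex _ (ex_intro2 _ _ s fs erefl)).
Qed.

(** Both sides are additive on short exact sequences and agree on simple objects. For [I] this is
    the result on projective covers in the opposite category. *)
Lemma homdim_hull S P I X : isSimple S -> isProjectiveCover S P ->
  isInjectiveHull S I -> homdim X I = homdim P X.
Proof.
move=> sS cP [iI [i [mi hull]]]; have [s fs] := finlength X.
have cI : @isProjectiveCover k (@opposite k A) S I.
  by split=> [Y Z e f|]; [exact: iI|exists i].
have homfin' (Y Z : @opposite k A) : finiteDimHom Y Z by exact: homfin.
have hAop := opposite_abelian hA.
elim: fs => [Y zY|X' Y T f g t ex sT _ IH].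
  by rewrite (homdim_zero homfin _ zY) (homdim_zerol homfin _ zY).
have -> : homdim Y I = (homdim T I + homdim X' I)%N :=
  homdim_exact homfin' cI.1 (shortExact_opposite ex).
rewrite (homdim_exact homfin cP.1 ex) -IH addnC (homdim_cover_simple hA homfin sS sT cP).
congr addn.
have -> : homdim T I = `[< @isomorphic k (@opposite k A) T S >] :=
  homdim_cover_simple hAop homfin' (simple_opposite hA sS) (simple_opposite hA sT) cI.
congr nat_of_bool; apply/asboolP/asboolP => -[h [h' [e1 e2]]].
  by apply: isomorphic_sym; exists h, h'.
by exists h', h.
Qed.

End Multiplicity.

Lemma zero_iso_shortExact (k : fieldType) (A : linearCategory k) (Z X Y : A)
    (f : mor X Y) : isZero Z -> isIso f -> shortExact (0 : mor Z X) f.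
Proof.
move=> zZ fi; have mf := isIso_mono fi; have [g [gf fg]] := fi; split.
  apply: isKernelI => [||W w /(mono_eq0 mf)->]; last by exists 0; rewrite compm0.
    by apply/monoP => W h _; have [_] := zZ W; apply.
  exact: compm0.
apply: isCokernelI => [||W w _]; [exact: isIso_epi|by have [] := zZ Y|].
by exists (w \c g); rewrite -compmA gf compm1.
Qed.

(** * The Grothendieck group *)

Section GrothendieckGroup.
Context {k : fieldType} {A : linearCategory k}.
Implicit Types X Y Z : A.

Lemma groupClass_exact X Y Z (f : mor X Y) (g : mor Y Z) :
  shortExact f g -> groupClass Y = groupClass X + groupClass Z.
Proof.
move=> ex; rewrite -raddfD; apply/eqP; rewrite -Quotient.idealrBE.
by apply/asboolP/grothendieckRelation_exact/ex.
Qed.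

Lemma groupClass_zero Z : isZero Z -> groupClass Z = 0.
Proof.
move=> zZ; apply: (addrI (groupClass Z)); rewrite addr0.
apply/esym/(groupClass_exact (zero_iso_shortExact zZ (f := idm Z) _)).
by exists (idm Z); rewrite comp1m.
Qed.

Lemma groupClass_iso X Y : isAbelian A -> isomorphic X Y -> groupClass X = groupClass Y.
Proof.
move=> hA [f fi]; have [Z zZ] := abelian_zero hA.
by rewrite (groupClass_exact (zero_iso_shortExact zZ fi)) groupClass_zero // add0r.
Qed.

(** The universal property of K(A): the linear extension of [phi] to the free group kills every
    defining relation, in particular the difference of the two sides. *)
Lemma additive_groupClass (phi : A -> nat) n (X : A) (Y : 'I_n -> A) (m : 'I_n -> nat) :
    (forall X' Y' Z' (f : mor X' Y') (g : mor Y' Z'), shortExact f g ->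
       phi Y' = (phi X' + phi Z')%N) ->
    groupClass X = \sum_(j < n) groupClass (Y j) *+ m j ->
  phi X = (\sum_(j < n) m j * phi (Y j))%N.
Proof.
move=> phiD eqX; pose ph (W : {classic A}) : int^o := (phi W)%:Z.
pose L : {additive freeOb A -> int^o} := HB.pack (fglift ph)
  (GRing.isZmodMorphism.Build (freeOb A) int^o (fglift ph) (lift_is_additive ph)).
have LU W : L (freeClass W) = phi W by rewrite /= liftU scale1r.
have L0 x : grothendieckRelation x -> L x = 0.
  elim=> [|{}x y _ Lx _ Ly|X' Y' Z' f g ex]; first by rewrite raddf0.
    by rewrite raddfB Lx Ly subr0.
  by rewrite raddfB raddfD !LU (phiD _ _ _ _ _ ex) PoszD subrr.
have : grothendieckRelation (freeClass X - \sum_(j < n) freeClass (Y j) *+ m j).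
  apply/asboolP; rewrite -[X in is_true X]/(_ \in @grothendieckRel k A).
  rewrite Quotient.idealrBE; apply/eqP; rewrite [LHS]eqX raddf_sum.
  by apply: eq_bigr => j _; rewrite raddfMn.
move/L0; rewrite raddfB LU raddf_sum => /eqP; rewrite subr_eq0 => /eqP eqL.
apply/eqP; rewrite -eqz_nat; apply/eqP.
rewrite [LHS]eqL (big_morph Posz PoszD erefl); apply: eq_bigr => j _.
by rewrite raddfMn LU -mulr_natl natz.
Qed.

End GrothendieckGroup.

(** * Images and filtrations in the presence of enough projectives *)

Section EnoughProjectives.
Context {k : fieldType} {A : linearCategory k}.
Hypothesis hA : isAbelian A.
Hypothesis enough : forall X : A, exists (P : A) (p : mor P X), isProjective P /\ epi p.
Implicit Types X Y Z W : A.

(** Maps from projectives serve as elements: enough of them exist to test surjectivity. *)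
Lemma epi_projective X Y (f : mor X Y) :
    (forall Q (y : mor Q Y), isProjective Q -> exists x, f \c x = y) ->
  epi f.
Proof.
move=> lift; apply/epiP => W h hf; have [Q [p [pQ ep]]] := enough Y.
by have [x fx] := lift Q p pQ; apply: (epi_eq0 ep); rewrite -fx compmA hf comp0m.
Qed.

(** [M] is the cokernel of the kernel of [f]. An element of [M] killed by [m] lifts, over a
    projective, to X; the lift lies in the kernel of [f], so the element is 0. *)
Lemma epi_mono_factor X Y (f : mor X Y) : exists M (e : mor X M) (m : mor M Y),
  [/\ epi e, mono m & m \c e = f].
Proof.
have [K [i ki]] := abelian_kernel hA f; have [M [e ce]] := abelian_cokernel hA i.
have [m me] := cokernel_desc ce ki.1; have ee := cokernel_epi ce.
exists M, e, m; split=> //; apply/monoP => W x mx.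
have [Q [p [pQ ep]]] := enough W; have [x' ex'] := pQ _ _ e (x \c p) ee.
apply: (epi_eq0 ep); have [|v iv] := kernel_lift (g := x') ki.
  by rewrite -me -compmA ex' compmA mx comp0m.
by rewrite -ex' -iv compmA ce.1 comp0m.
Qed.

(** [filtration_cons] adds a factor at the top; this adds one at the bottom, pulling the filtration
    of Y back along [q]. *)
Lemma filtration_extend (C : A -> Prop) K X Y (f : mor K X) (q : mor X Y) s :
  shortExact f q -> C K -> filtration C Y s -> filtration C X (rcons s K).
Proof.
move=> ex CK fs; elim: fs X f q ex => [{}Y zY|Y' {}Y T f' g t ex' CT _ IH] X f q ex /=.
  have [] : isIso f; last move=> g [gf fg].
    apply: mono_epi_iso => //; first exact: kernel_mono ex.1.
    apply/epiP => W h hf; have [u <-] := cokernel_desc ex.2 hf.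
    by have [/(_ u)-> _] := zY W; rewrite comp0m.
  have [Z zZ] := abelian_zero hA.
  apply: (@filtration_cons _ _ _ Z _ _ 0 g) => //; last exact: filtration_nil.
  by apply: zero_iso_shortExact => //; exists f.
have eq := cokernel_epi ex.2; have eg := cokernel_epi ex'.2.
(* [X'] is the preimage of [Y'] in [X]; it remains to see that 0 -> K -> X' -> Y' -> 0 is exact. *)
have [X' [i exi]] := epi_exact hA (epi_comp eg eq).
have mi := kernel_mono exi.1; have mf' := kernel_mono ex'.1.
apply: (filtration_cons exi CT).
have [|q' f'q'] := kernel_lift (g := q \c i) ex'.1; first by rewrite compmA exi.1.1.
have [|f1 if1] := kernel_lift (g := f) exi.1; first by rewrite -compmA ex.1.1 compm0.
apply: (IH _ f1 q'); apply: epi_shortExact => //.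
  apply: epi_projective => Q y pQ; have [x qx] := pQ _ _ q (f' \c y) eq.
  have [|x' ix'] := kernel_lift (g := x) exi.1.
    by rewrite -compmA qx compmA ex'.1.1 comp0m.
  by exists x'; apply: mf'; rewrite compmA f'q' -compmA ix'.
apply: isKernelI => [W u v uv||W w q'w].
- by apply: (kernel_mono ex.1); rewrite -if1 -!compmA uv.
- by apply: (mono_eq0 mf'); rewrite compmA f'q' -compmA if1 ex.1.1.
have [|v fv] := kernel_lift (g := i \c w) ex.1.
  by rewrite compmA -f'q' -compmA q'w compm0.
by exists v; apply: mi; rewrite compmA if1.
Qed.

End EnoughProjectives.

Lemma filtration_sub (k : fieldType) (A : linearCategory k) (C C' : A -> Prop) X s :
  (forall T, C T -> C' T) -> filtration C X s -> filtration C' X s.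
Proof.
move=> CC'; elim=> [Y zY|X' Y T f g t ex CT _ IH]; first exact: filtration_nil.
exact: filtration_cons ex (CC' _ CT) IH.
Qed.

(** A one-dimensional End(X) is spanned by the identity, which is nonzero, so a |-> a id is an
    algebra isomorphism from k. *)
Lemma trivialEndP (k : fieldType) (A : linearCategory k) (X : A) :
  finiteDimHom X X -> trivialEnd X <-> homdim X X = 1%N.
Proof.
move=> fX; split=> [[phi [phi1 _ bphi]]|dim1].
  have phiZ a : phi a = a *: idm X.
    by rewrite -phi1 -linearZ /=; congr (phi _); rewrite /GRing.scale /= mulr1.
  apply: (vdim_line fX (x := idm X)) => [id0|f].
    have /(bij_inj bphi)/eqP : phi 1 = phi 0 by rewrite phi1 id0 linear0.
    by rewrite oner_eq0.
  by have [psi _ psiK] := bphi; exists (psi f); rewrite -phiZ psiK.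
have id0 : idm X <> 0.
  move=> id0; have /(vdim_eq0 fX) : forall f : mor X X, f = 0; last by rewrite -/(homdim X X) dim1.
  by move=> f; rewrite -[f]comp1m id0 comp0m.
have lin : linear (fun a : k^o => a *: idm X).
  by move=> a x y; rewrite scalerDl scalerA.
pose phi : {linear k^o -> mor X X} := HB.pack (fun a : k^o => a *: idm X)
  (GRing.isLinear.Build k k^o (mor X X) *:%R (fun a : k^o => a *: idm X) lin).
exists phi; split=> [|a b|]; rewrite /phi /=.
- by rewrite scale1r.
- by rewrite compZm compmZ comp1m scalerA.
have [psi psiP] := choice (fun f => vdim1_line f fX dim1 id0).
exists psi => [a|f]; last by rewrite -psiP.
have /eqP := psiP (a *: idm X); rewrite -subr_eq0 -scalerBl scaler_eq0.
by case/orP=> [|/eqP//]; rewrite subr_eq0 => /eqP.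
Qed.

(** * Standard and costandard objects *)

Section Standard.
Context {k : closedFieldType} {A : linearCategory k}.
Hypotheses (hA : isAbelian A) (hfin : isDeligneFinite A).
Context {n : nat}.
Variables S P I D N : 'I_n -> A.
Hypotheses (hS : isSimpleEnumeration S)
  (hP : forall i, isProjectiveCover (S i) (P i))
  (hI : forall i, isInjectiveHull (S i) (I i))
  (hD : isStandard S P D) (hN : isCostandard S I N).
Implicit Types X Y Z T : A.

Let homfin : forall X Y : A, finiteDimHom X Y := deligne_hom hfin.
Let enough := deligne_projectives hfin.
Let finlength := deligne_length hfin.

Lemma simpleS i : isSimple (S i). Proof. by case: hS. Qed.

Lemma homdim_cover_S i j : homdim (P i) (S j) = (j == i).
Proof.
rewrite (homdim_cover_simple hA homfin (simpleS i) (simpleS j) (hP i)).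
congr nat_of_bool; apply/asboolP/eqP => [|->]; last exact: isomorphic_refl.
by case: hS => _ + _; apply.
Qed.

Lemma homdim_cover_exact l X Y Z (f : mor X Y) (g : mor Y Z) :
  shortExact f g -> homdim (P l) Y = (homdim (P l) X + homdim (P l) Z)%N.
Proof. exact: (homdim_exact homfin (hP l).1). Qed.

(** The top composition factor S_l of a nonzero object contributes 1 to dim Hom(P_l, X). *)
Lemma homdim_cover_zero X : (forall l, homdim (P l) X = 0%N) -> isZero X.
Proof.
move=> X0; have [s fs] := finlength X; case: fs X0 => // X' Y T f g t ex sT _ Y0.
have [l iTl] : exists l, isomorphic T (S l) by case: hS => _ _; apply.
have := Y0 l; rewrite (homdim_cover_exact l ex) (homdim_iso homfin _ iTl).
by rewrite homdim_cover_S eqxx addn1.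
Qed.

(** This numerical form of membership makes closure under subobjects and quotients immediate. *)
Lemma simpleFiltP i X :
  simpleFilt S i X <-> forall l : 'I_n, (i < l)%N -> homdim (P l) X = 0%N.
Proof.
split=> [[s fs] l il|].
  elim: fs => [Y zY|X' Y T f g t ex [j [ji iTj]] _ IH]; first exact: homdim_zero.
  rewrite (homdim_cover_exact l ex) IH (homdim_iso homfin _ iTj) homdim_cover_S.
  by rewrite (_ : j == l = false) //; apply/eqP => jl; rewrite jl leqNgt il in ji.
have [s fs] := finlength X; move=> X0; exists s; elim: fs X0.
  by move=> Y zY _; exact: filtration_nil.
move=> X' Y T f g t ex sT _ IH Y0.
have X'T0 (l : 'I_n) : (i < l)%N -> homdim (P l) X' = 0%N /\ homdim (P l) T = 0%N.
  move=> /Y0/eqP; rewrite (homdim_cover_exact l ex) addn_eq0.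
  by case/andP=> /eqP-> /eqP->.
apply: (filtration_cons ex) => [|]; last by apply: IH => l /X'T0[].
have [l iTl] : exists l, isomorphic T (S l) by case: hS => _ _; apply.
exists l; split=> //; rewrite leqNgt; apply/negP => /X'T0[_].
by rewrite (homdim_iso homfin _ iTl) homdim_cover_S eqxx.
Qed.

Lemma simpleFilt_mono i X Y (f : mor X Y) : mono f -> simpleFilt S i Y -> simpleFilt S i X.
Proof.
move=> mf /simpleFiltP Y0; apply/simpleFiltP => l il; apply/eqP.
by rewrite -leqn0 -(Y0 l il) (homdim_mono homfin _ mf).
Qed.

Lemma simpleFilt_epi i X Y (f : mor X Y) : epi f -> simpleFilt S i X -> simpleFilt S i Y.
Proof.
move=> ef /simpleFiltP X0; apply/simpleFiltP => l il; apply/eqP.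
by rewrite -leqn0 -(X0 l il) (homdim_epi homfin (hP l).1 ef).
Qed.

Lemma simpleFilt_le (i j : 'I_n) X : (i <= j)%N -> simpleFilt S i X -> simpleFilt S j X.
Proof.
move=> ij /simpleFiltP X0; apply/simpleFiltP => l jl; apply: X0.
exact: leq_ltn_trans ij jl.
Qed.

(** Maximality concerns epis only; a general map to an object of A_i factors through its image,
    which lies in A_i as well. *)
Lemma standardP i : exists q : mor (P i) (D i), epi q /\
  forall X (f : mor (P i) X), simpleFilt S i X -> exists g, g \c q = f.
Proof.
have [_ [q [eq univ]]] := hD i; exists q; split=> // X f CX.
have [M [e [m [ee mm <-]]]] := epi_mono_factor hA enough f.
have [|g <-] := univ M e _ ee; first exact: simpleFilt_mono mm CX.
by exists (m \c g); rewrite compmA.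
Qed.

Lemma homdim_standard i X : simpleFilt S i X -> homdim (D i) X = homdim (P i) X.
Proof.
move=> CX; have [q [eq univ]] := standardP i; apply/eqP; rewrite eqn_leq.
rewrite (homdim_epil homfin _ eq).
apply: (vdim_surj (homfin _ _) (homfin _ _) (compmr_linear q)) => f.
exact: univ.
Qed.

(** The image in I_i of an object of A_i lies in N_i, so Hom(X, N_i) = Hom(X, I_i). *)
Lemma homdim_costandard i X : simpleFilt S i X -> homdim X (N i) = homdim (P i) X.
Proof.
move=> CX; rewrite -(homdim_hull hA homfin finlength X (simpleS i) (hP i) (hI i)).
have [_ [u [mu univ]]] := hN i; apply/eqP; rewrite eqn_leq.
rewrite (homdim_mono homfin _ mu).
apply: (vdim_surj (homfin _ _) (homfin _ _) (compm_linear u)) => f.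
have [M [e [m [ee mm <-]]]] := epi_mono_factor hA enough f.
have [|g <-] := univ M m _ mm; first exact: simpleFilt_epi ee CX.
by exists (g \c e); rewrite compmA.
Qed.

(** The object of smaller index lies in the subcategory of the larger index, where the Hom-dimension
    is the multiplicity of the larger-index simple, and that is 0. *)
Lemma homdim_standard_costandard i j : i != j -> homdim (D i) (N j) = 0%N.
Proof.
move=> nij; have [CD _] := hD i; have [CN _] := hN j; case: (ltngtP i j) => [ij|ji|/val_inj ij].
- rewrite homdim_costandard; last exact: simpleFilt_le (ltnW ij) CD.
  by move/simpleFiltP: CD; apply.
- rewrite homdim_standard; last exact: simpleFilt_le (ltnW ji) CN.
  by move/simpleFiltP: CN; apply.
- by rewrite ij eqxx in nij.
Qed.

Lemma homdim_standard_costandard_diag i : homdim (D i) (N i) = homdim (P i) (D i).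
Proof. by apply: homdim_costandard; case: (hD i). Qed.

(** For X = P_i the coefficient dim Hom(P_i, N_j) is [N_j:S_i], so this is the multiplicity of S_l
    in the right-hand side of the formula in K(A). *)
Definition standardBound X l := (\sum_(j < n) homdim X (N j) * homdim (P l) (D j))%N.

(** One induction on the length of X proves both parts, since the equality case for X uses the bound
    for the quotient Y. *)
Lemma standardBoundP X : (forall l, (homdim (P l) X <= standardBound X l)%N) /\
  ((forall l, homdim (P l) X = standardBound X l) ->
   Filt (fun j => homdim X (N j) <> 0%N) D X).
Proof.
have [c] := ubnP (\sum_l homdim (P l) X)%N; elim: c X => // c IH X ltc.
have [X0|] := pselect (forall l, homdim (P l) X = 0%N).
  split=> [l|_]; first by rewrite X0.
  by exists [::]; apply/filtration_nil/homdim_cover_zero.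
move/existsNP => [l0 /eqP Xl0].
case: (arg_maxnP (fun l : 'I_n => l : nat) (P := fun l => homdim (P l) X != 0%N) Xl0).
move=> t Xt maxt.
have CX : simpleFilt S t X.
  apply/simpleFiltP => l tl; apply: contrapT => /eqP /maxt.
  by rewrite /= leqNgt tl.
have [q [eq univ]] := standardP t.
have [f0 nf0] := vdim_neq0 (elimN eqP Xt) (homfin _ _).
have [u uq] := univ X f0 CX.
have [M [e [m [ee mm me]]]] := epi_mono_factor hA enough u.
have [Y [p ex]] := mono_exact hA mm; have ep := cokernel_epi ex.2.
have dX l := homdim_cover_exact l ex.
have leM l := homdim_epi homfin (hP l).1 ee.
have Mt : (0 < homdim (P t) M)%N.
  apply: (vdim_gt0 (x := e \c q) (homfin _ _)) => eq0.
  by apply: nf0; rewrite -uq -me -compmA eq0 compm0.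
have ltY : (\sum_l homdim (P l) Y < c)%N.
  rewrite -ltnS; apply: leq_trans ltc; rewrite ltnS (eq_bigr _ (fun l _ => dX l)).
  by rewrite big_split /= -add1n leq_add2r (bigD1 t) //= ltn_addr.
have [leY eqY] := IH Y ltY.
(* On A_t, dim Hom(-, N_t) is the multiplicity of S_t, which drops by at least one as [M] contains
   S_t. *)
have hY j : ((j == t) + homdim Y (N j) <= homdim X (N j))%N.
  case: (eqVneq j t) => [->|_]; last by rewrite add0n (homdim_epil homfin _ ep).
  rewrite !homdim_costandard //; last exact: simpleFilt_epi ep CX.
  by rewrite dX leq_add2r.
have leB l : (homdim (P l) (D t) + standardBound Y l <= standardBound X l)%N.
  rewrite /standardBound [X in (X + _)%N](_ : _ =
    \sum_(j < n) (j == t) * homdim (P l) (D j))%N.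
    rewrite -big_split leq_sum // => j _ /=.
    by rewrite -mulnDl leq_mul2r hY orbT.
  rewrite (bigD1 t) //= eqxx mul1n big1 ?addn0 // => j /negbTE->.
  by rewrite mul0n.
split=> [l|eqX].
  rewrite dX; apply: leq_trans (leB l); exact: leq_add (leM l) (leY l).
(* The bounds for [M] and [Y] add up to at most [standardBound X l], so equality there makes both
   tight. *)
have eqMY l : homdim (P l) M = homdim (P l) (D t) /\ homdim (P l) Y = standardBound Y l.
  have := leB l; rewrite -eqX dX => h; split; apply/eqP; rewrite eqn_leq ?leM ?leY.
    by rewrite -(leq_add2r (homdim (P l) Y)) (leq_trans _ h) // leq_add2l.
  by rewrite -(leq_add2l (homdim (P l) M)) (leq_trans _ h) // leq_add2r.
have [|s fs] := eqY; first by move=> l; case: (eqMY l).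
(* [M] is the bottom factor. It is isomorphic to D_t because the kernel of [e] has all
   multiplicities 0. *)
exists (rcons s M); apply: (filtration_extend hA enough ex).
  exists t; split; first by rewrite homdim_costandard //; exact/eqP.
  apply: isomorphic_sym; exists e; apply: mono_epi_iso => //.
  have [K [i exi]] := epi_exact hA ee; apply: (kernel_zero_mono exi.1).
  apply: homdim_cover_zero => l; have := homdim_cover_exact l exi.
  by rewrite (eqMY l).1 => /eqP; rewrite -{1}[X in X == _]add0n eqn_add2r => /eqP.
apply: filtration_sub fs => T [j [hj iT]]; exists j; split=> // h0; apply: hj.
by apply/eqP; rewrite -leqn0 -h0; exact: (homdim_epil homfin _ ep).
Qed.

(** [m] counts the occurrences of each D_j. The last clause is an inequality because Hom(-, N_j) is
    only left exact; [diag] gives dim Hom(D_j, N_j) = 1. *)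
Lemma Filt_standard_count (r : 'I_n -> Prop) X :
    (forall j, homdim (P j) (D j) = 1%N) -> Filt r D X ->
  exists m : 'I_n -> nat,
    [/\ groupClass X = \sum_(j < n) groupClass (D j) *+ m j,
        forall l, homdim (P l) X = (\sum_(j < n) m j * homdim (P l) (D j))%N
      & forall j, (homdim X (N j) <= m j)%N].
Proof.
move=> diag [s]; elim=> [Y zY|X' Y T f g t ex [i [_ iTi]] _ [m [mK mP mN]]].
  exists (fun=> 0%N); split=> [|l|j].
  - by rewrite groupClass_zero // big1.
  - by rewrite homdim_zero // big1.
  - by rewrite homdim_zerol.
exists (fun j => (m j + (j == i))%N); split=> [|l|j].
- rewrite (groupClass_exact ex) mK (groupClass_iso hA iTi).
  under [RHS]eq_bigr do rewrite mulrnDr.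
  rewrite big_split /=; congr (_ + _); rewrite (bigD1 i) //= eqxx mulr1n.
  by rewrite big1 ?addr0 // => j /negbTE->; rewrite mulr0n.
- rewrite (homdim_cover_exact l ex) mP (homdim_iso homfin _ iTi).
  under [RHS]eq_bigr do rewrite mulnDl.
  rewrite big_split /=; congr (_ + _)%N; rewrite (bigD1 i) //= eqxx mul1n.
  by rewrite big1 ?addn0 // => j /negbTE->; rewrite mul0n.
apply: leq_trans (homdim_left_exactl homfin _ ex) _; rewrite leq_add //.
rewrite (homdim_isol homfin _ iTi); case: eqVneq => [->|nji].
  by rewrite homdim_standard_costandard_diag diag.
by rewrite homdim_standard_costandard // eq_sym.
Qed.

End Standard.

Theorem theorem1 (k : closedFieldType) (A : linearCategory k)
    (hA : isAbelian A) (hfin : isDeligneFinite A)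
    (n : nat) (S P I D N : 'I_n -> A)
    (hS : isSimpleEnumeration S)
    (hP : forall i, isProjectiveCover (S i) (P i))
    (hI : forall i, isInjectiveHull (S i) (I i))
    (hD : isStandard S P D)
    (hN : isCostandard S I N) :
  highestWeight P D <->
  (forall i : 'I_n,
     multiplicity (D i) (S i) = 1%N /\
     groupClass (P i) =
       \sum_(j < n) groupClass (D j) *+ multiplicity (N j) (S i)).
Proof.
have homfin := deligne_hom hfin.
have multE X i : multiplicity X (S i) = homdim (P i) X.
  by apply: homdim_multiplicity => //; [exact: deligne_length|case: hS].
(* D_i lies in A_i, so End(D_i) = Hom(P_i, D_i): triviality of End(D_i) means [D_i:S_i] = 1. *)
have EndE i : homdim (D i) (D i) = homdim (P i) (D i).
  by apply: (homdim_standard hA hfin hS hP hD); case: (hD i).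
have bound i := standardBoundP hA hfin hS hP hI hD hN (P i).
split=> [hw i|num i].
  have diag j : homdim (P j) (D j) = 1%N.
    by rewrite -EndE; apply/trivialEndP => //; case: (hw j).
  split; first by rewrite multE.
  have [_ FP] := hw i.
  have [m [-> mP mN]] := Filt_standard_count hA hfin hS hP hI hD hN diag FP.
  apply: eq_bigr => j _; congr (_ *+ _); rewrite multE; apply/eqP.
  (* Compare the multiplicities of S_j in P_i: the coefficient of D_j is 1, and the terms l != j are
     absorbed by dim Hom(P_i, N_l) <= m_l. *)
  rewrite eqn_leq mN andbT; have := (bound i).1 j.
  rewrite mP /standardBound (bigD1 j) //= [leqRHS](bigD1 j) //= diag !muln1 => le.
  rewrite -(leq_add2r (\sum_(l < n | l != j) m l * homdim (P j) (D l))).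
  by rewrite (leq_trans le) // leq_add2l leq_sum // => l _; rewrite leq_mul2r mN orbT.
split; first by apply/trivialEndP => //; rewrite EndE -multE; case: (num i).
(* Applying dim Hom(P_l, -) to the formula in K(A) yields the equality case. *)
have [|s fs] := (bound i).2.
  move=> l; have [_ eqP] := num i.
  rewrite (additive_groupClass (phi := homdim (P l)) _ eqP) => [|X Y Z f g ex].
    by apply: eq_bigr => j _; rewrite multE.
  exact: homdim_cover_exact ex.
(* A factor D_j occurs only if Hom(P_i, N_j) is nonzero, and N_j in A_j then forces i <= j. *)
exists s; apply: filtration_sub fs => T [j [hj iT]]; exists j; split=> //.
rewrite leqNgt; apply/negP => ji; apply: hj.
by have [/(simpleFiltP hA hfin hS hP)/(_ i ji)] := hN j.
Qed.
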